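(* Every positive stochastic choice function on a finite set $X$ is an unrestricted cross-nested logit.
   Context: $X$ is a finite set, $\mathscr{A}$ the nonempty subsets; a stochastic choice function is $p:X\times\mathscr{A}\to[0,1]$ with $\sum_{a\in A}p(a,A)=1$, $p(x,A)=0$ for $x\notin A$, and (positivity) $p(a,A)>0$ for $a\in A$. $p$ is an unrestricted generalized nested logit if there exist a collection of subsets $X_1,\dots,X_K$ of $X$ (not necessarily disjoint), numbers $\alpha^k_x\ge 0$ ($k\le K$, $x\in X$) with $\sum_{k=1}^K\alpha^k_x=1$ for each $x$ and $\alpha^k_x=0$ iff $x\notin X_k$, a function $u:X\to\mathbb{R}_{++}$ and parameters $\lambda_1,\dots,\lambda_K>0$ such that for every $A\in\mathscr{A}$ and $x\in A$, $p(x,A)=\sum_{k:\,x\in A\cap X_k}\frac{(\alpha^k_x u(x))^{1/\lambda_k}}{\sum_{y\in A\cap X_k}(\alpha^k_y u(y))^{1/\lambda_k}}\cdot\frac{\Big(\sum_{y\in A\cap X_k}(\alpha^k_y u(y))^{1/\lambda_k}\Big)^{\lambda_k}}{\sum_{l:\,A\cap X_l\ne\emptyset}\Big(\sum_{z\in A\cap X_l}(\alpha^l_z u(z))^{1/\lambda_l}\Big)^{\lambda_l}}$. It is an unrestricted cross-nested logit if moreover $\lambda_k=\lambda_{k'}$ for all $k,k'\le K$. *)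

(* Defs.v *)
From HB Require Import structures.
From mathcomp Require Import all_boot all_order all_algebra.
From mathcomp Require Import reals exp.
Set Implicit Arguments. Unset Strict Implicit. Unset Printing Implicit Defensive.
Import Order.TTheory GRing.Theory Num.Theory.
Local Open Scope ring_scope.

Section Defs.
Variables (R : realType) (X : finType).

Definition positive_scf (p : X -> {set X} -> R) : Prop :=
  forall A : {set X}, A != set0 ->
    [/\ \sum_(a in A) p a A = 1,
        (forall x, x \notin A -> p x A = 0) &
        (forall a, a \in A -> 0 < p a A)].

Definition gnl_w (K : nat) (alpha : 'I_K -> X -> R) (u : X -> R)
  (lam : 'I_K -> R) (k : 'I_K) (y : X) : R :=
  (alpha k y * u y) `^ (lam k)^-1.

Definition gnl_S (K : nat) (Xk : 'I_K -> {set X}) (alpha : 'I_K -> X -> R)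
  (u : X -> R) (lam : 'I_K -> R) (k : 'I_K) (A : {set X}) : R :=
  \sum_(y in A :&: Xk k) gnl_w alpha u lam k y.

Definition gnl_prob (K : nat) (Xk : 'I_K -> {set X}) (alpha : 'I_K -> X -> R)
  (u : X -> R) (lam : 'I_K -> R) (x : X) (A : {set X}) : R :=
  \sum_(k : 'I_K | x \in A :&: Xk k)
     (gnl_w alpha u lam k x / gnl_S Xk alpha u lam k A) *
     ((gnl_S Xk alpha u lam k A) `^ (lam k) /
      \sum_(l : 'I_K | A :&: Xk l != set0) (gnl_S Xk alpha u lam l A) `^ (lam l)).

Definition gnl_params (K : nat) (Xk : 'I_K -> {set X}) (alpha : 'I_K -> X -> R)
  (u : X -> R) (lam : 'I_K -> R) : Prop :=
  [/\ (forall k x, 0 <= alpha k x),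
      (forall x, \sum_(k < K) alpha k x = 1),
      (forall k x, alpha k x = 0 <-> x \notin Xk k),
      (forall x, 0 < u x) &
      (forall k, 0 < lam k)].

Definition is_unrestricted_gnl (p : X -> {set X} -> R) : Prop :=
  exists K (Xk : 'I_K -> {set X}) (alpha : 'I_K -> X -> R) (u : X -> R)
         (lam : 'I_K -> R),
    gnl_params Xk alpha u lam /\
    forall A : {set X}, A != set0 -> forall x, x \in A ->
      p x A = gnl_prob Xk alpha u lam x A.

Definition is_unrestricted_cnl (p : X -> {set X} -> R) : Prop :=
  exists K (Xk : 'I_K -> {set X}) (alpha : 'I_K -> X -> R) (u : X -> R)
         (lam : 'I_K -> R),
    [/\ gnl_params Xk alpha u lam,
        (forall k k', lam k = lam k') &
        forall A : {set X}, A != set0 -> forall x, x \in A ->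
          p x A = gnl_prob Xk alpha u lam x A].

End Defs.

(* Main.v *)
(** Only the products [alpha k x * u x] matter, so a cross-nested logit with common
    [lam = n + 1] is given by arbitrary nonnegative weights [w k x] and scales [c k],
    choice probabilities from [A] being proportional to
    [\sum_k c k * w k x * (\sum_(y in A) w k y) ^ n].  Take one nest for each pair
    [(B, x)] with [x] in [B], of weight [1] at [x], [delta] on the rest of [B] and [0]
    outside, and ask that the sum above equal [delta ^- #|A| * p x A].  This is a
    square linear system in [c].  After rescaling it has diagonal [1], and its other
    entries are at most [delta]: for [B = A] by the choice of weights, for [B]
    strictly inside [A] because of the factor [delta ^- #|A|], and for [B] not inside
    [A] because the nest loses a fixed fraction of its weight, which the power [n]
    turns into an arbitrarily small factor.  For small [delta] the solution is close
    to [p > 0], hence positive. *)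
Require Import Defs.
From HB Require Import structures.
From mathcomp Require Import all_boot all_order all_algebra.
From mathcomp Require Import reals exp.
From mathcomp Require Import normedtype sequences.
From mathcomp Require Import ring lra.
Set Implicit Arguments. Unset Strict Implicit. Unset Printing Implicit Defensive.
Import Order.TTheory GRing.Theory Num.Theory numFieldNormedType.Exports.
Local Open Scope ring_scope.

(** * Linear systems close to the identity *)

Section NearIdentity.
Variables (R : realFieldType) (I : finType) (M : I -> I -> R) (delta : R).
Hypothesis diagM : forall i, M i i = 1.
Hypothesis offdiagM : forall i j, i != j -> `|M i j| <= delta.
Hypothesis delta_ge0 : 0 <= delta.

(** As the diagonal is [1], [b i - d i] is the off-diagonal part of row [i]: at most [#|I|] terms,
    each bounded by [delta * D]. *)
Lemma near_id_dist (d b : I -> R) (D : R) :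
  (forall i, \sum_j M i j * d j = b i) -> (forall i, `|d i| <= D) ->
  forall i, `|d i - b i| <= #|I|%:R * delta * D.
Proof.
move=> Md dD i; have D0 : 0 <= D := le_trans (normr_ge0 _) (dD i).
rewrite -Md (bigD1 i) //= diagM mul1r opprD addNKr normrN.
apply: le_trans (ler_norm_sum _ _ _) _.
apply: (@le_trans _ _ (\sum_(j | j != i) delta * D)).
  apply: ler_sum => j ji; rewrite normrM ler_pM //.
  by apply: offdiagM; rewrite eq_sym.
rewrite sumr_const -mulrA mulr_natl; apply: ler_wpMn2l; first exact: mulr_ge0.
exact: max_card.
Qed.

Hypothesis small_delta : #|I|%:R * delta <= 2^-1.

Lemma near_id_bound (d b : I -> R) (C : R) :
  (forall i, \sum_j M i j * d j = b i) -> (forall i, `|b i| <= C) ->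
  forall i, `|d i| <= 2 * C.
Proof.
move=> Md bC i.
(* At an index maximising [|d|], the distance estimate with [D = |d i0|] gives
   [|d i0| <= C + |d i0| / 2]. *)
have [i0 _ maxd] := @Order.TotalTheory.arg_maxP _ R I i predT (fun j => `|d j|) isT.
apply: le_trans (maxd i isT) _.
have := near_id_dist Md (fun j => maxd j isT) i0.
have : #|I|%:R * delta * `|d i0| <= 2^-1 * `|d i0| by exact: ler_wpM2r.
have := bC i0; have := ler_normD (d i0 - b i0) (b i0); rewrite subrK.
lra.
Qed.

(** The bound with [C = 0] makes the kernel trivial, and an injective square matrix is
    invertible. *)
Lemma near_id_surj (b : I -> R) : exists d, forall i, \sum_j M i j * d j = b i.
Proof.
(* The transpose of [M], since vectors are rows acting from the left. *)
pose A : 'M[R]_#|I| := \matrix_(i, j) M (enum_val j) (enum_val i).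
have mulA (v : 'rV_#|I|) i :
    \sum_j M i j * v 0 (enum_rank j) = (v *m A) 0 (enum_rank i).
  rewrite mxE (reindex enum_rank) /=; last first.
    by exists enum_val => j _; rewrite ?enum_valK ?enum_rankK.
  by apply: eq_bigr => j _; rewrite mxE !enum_rankK mulrC.
have unitA : A \in unitmx.
  rewrite -row_free_unit -kermx_eq0; apply/eqP/row_matrixP => k; rewrite row0.
  set v := row k _; have vA : v *m A = 0 by rewrite -row_mul mulmx_ker row0.
  apply/rowP => j; rewrite [RHS]mxE -[j]enum_valK.
  have Mv i : \sum_j M i j * v 0 (enum_rank j) = 0 by rewrite mulA vA mxE.
  have := @near_id_bound _ _ 0 Mv _ (enum_val j).
  by rewrite normr0 => /(_ (fun=> lexx _)); rewrite mulr0 normr_le0 => /eqP.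
exists (fun j => ((\row_i b (enum_val i)) *m invmx A) 0 (enum_rank j)) => i.
by rewrite mulA mulmxKV // mxE enum_rankK.
Qed.

Lemma near_id_pos_solution (b : I -> R) (beta : R) :
    (forall i, beta <= b i <= 1) -> 0 < beta -> 2 * (#|I|%:R * delta) < beta ->
  exists2 d, (forall i, 0 < d i) & forall i, \sum_j M i j * d j = b i.
Proof.
move=> b_in beta0 delta_beta; have [d Md] := near_id_surj b; exists d => // i.
have b1 j : `|b j| <= 1.
  by have /andP[? ?] := b_in j; rewrite ger0_norm //; lra.
have := near_id_dist Md (near_id_bound Md b1) i.
by rewrite ler_norml => /andP[+ _]; have /andP[] := b_in i; lra.
Qed.

End NearIdentity.

(** * From power weights to a cross-nested logit *)

Section PowerWeights.
Variables (R : realType) (X : finType) (p : X -> {set X} -> R).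

(* Here [lam = n.+1] for every nest. The constraint [\sum_k alpha k x = 1] costs
   nothing, since [u] is free to absorb the normalisation. *)
Lemma cnl_of_weights (I : finType) (w : I -> X -> R) (c : I -> R)
    (m : {set X} -> R) (n : nat) :
    positive_scf p ->
    (forall i x, 0 <= w i x) -> (forall x, exists i, 0 < w i x) ->
    (forall i, 0 < c i) -> (forall A, 0 < m A) ->
    (forall (A : {set X}) x, x \in A ->
      \sum_i c i * (w i x * (\sum_(y in A) w i y) ^+ n) = m A * p x A) ->
  is_unrestricted_cnl p.
Proof.
move=> pP w0 wcov c0 m0 eqN.
pose lam : R := n.+1%:R.
have lam0 : lam != 0 by rewrite pnatr_eq0.
(* [v] will be the product of [alpha] and [u]; its [lam]-th root is linear in [w]. *)
pose v i x := c i * w i x ^+ n.+1.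
pose u x := \sum_i v i x.
have v0 i x : 0 <= v i x by rewrite mulr_ge0 ?exprn_ge0 // ltW.
have u0 x : 0 < u x.
  have [i wi] := wcov x; rewrite /u (bigD1 i) //=.
  by rewrite ltr_pwDl ?mulr_gt0 ?exprn_gt0 ?sumr_ge0.
pose Xk (k : 'I_#|I|) := [set x | 0 < w (enum_val k) x].
pose alpha (k : 'I_#|I|) x := v (enum_val k) x / u x.
have reindexI (F : I -> R) : \sum_(k < #|I|) F (enum_val k) = \sum_i F i.
  symmetry; apply: reindex; exists enum_rank => i _.
    exact: enum_valK.
  exact: enum_rankK.
pose s i := c i `^ lam^-1.
have s0 i : 0 < s i by exact: powR_gt0.
have sX i : s i ^+ n.+1 = c i.
  by rewrite -powR_mulrn ?ltW // -powRrM mulVf // powRr1 // ltW.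
have gnl_wE k x : gnl_w alpha u (fun=> lam) k x = s (enum_val k) * w (enum_val k) x.
  rewrite /gnl_w divfK ?gt_eqF // powRM ?exprn_ge0 // ?ltW //; congr (_ * _).
  by rewrite -powR_mulrn // -powRrM mulfV // powRr1.
have gnl_SE k A : gnl_S Xk alpha u (fun=> lam) k A =
    s (enum_val k) * \sum_(y in A) w (enum_val k) y.
  rewrite /gnl_S mulr_sumr [RHS](big_setID (Xk k)) /= [X in _ + X]big1.
    by rewrite addr0; apply: eq_bigr => y _; exact: gnl_wE.
  move=> y; rewrite !inE -leNgt => /andP[wy _].
  suff -> : w (enum_val k) y = 0 by rewrite mulr0.
  by apply/le_anti/andP.
have S0 i (A : {set X}) : 0 <= \sum_(y in A) w i y by exact: sumr_ge0.
have gnl_powE k A : gnl_S Xk alpha u (fun=> lam) k A `^ lam =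
    c (enum_val k) * (\sum_(y in A) w (enum_val k) y) ^+ n.+1.
  rewrite gnl_SE powR_mulrn; last by rewrite mulr_ge0 // ltW.
  by rewrite exprMn sX.
(* Summing [eqN] over [x] in [A] gives the denominator, because the choice probabilities add up to
   [1]. *)
have denE (A : {set X}) : A != set0 ->
    \sum_(l | A :&: Xk l != set0) gnl_S Xk alpha u (fun=> lam) l A `^ lam = m A.
  move=> An0; have [p1 _ _] := pP A An0.
  rewrite -[m A]mulr1 -p1 mulr_sumr.
  under [RHS]eq_bigr => x xA do rewrite -eqN //.
  rewrite exchange_big /= -reindexI big_mkcond /=; apply: eq_bigr => k _.
  under [RHS]eq_bigr do rewrite mulrCA.
  case: ifPn => [_|].
    by rewrite gnl_powE -mulr_suml exprS; ring.
  rewrite negbK => /eqP AX0; rewrite big1 // => x xA.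
  suff -> : w (enum_val k) x = 0 by rewrite mul0r.
  apply/le_anti; rewrite w0 andbT leNgt; apply/negP => wx.
  by have := in_set0 x; rewrite -AX0 !inE xA wx.
exists #|I|, Xk, alpha, u, (fun=> lam); split=> //.
  split=> //.
  - by move=> k x; rewrite divr_ge0 // ltW.
  - move=> x; rewrite -mulr_suml (reindexI (fun i => v i x)).
    by rewrite -/(u x) divff // gt_eqF.
  - move=> k x; rewrite inE -leNgt; split => [/eqP|wx].
      rewrite mulf_eq0 invr_eq0 (gt_eqF (u0 x)) orbF mulf_eq0 (gt_eqF (c0 _)) /=.
      by rewrite expf_eq0 /= => /eqP ->.
    have /le_anti wx0 : w (enum_val k) x <= 0 <= w (enum_val k) x by rewrite wx w0.
    by rewrite /alpha /v wx0 expr0n /= mulr0 mul0r.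
move=> A An0 x xA; rewrite /gnl_prob denE //.
transitivity ((m A)^-1 * (m A * p x A)); first by rewrite mulKf // gt_eqF.
rewrite -eqN // -reindexI mulr_sumr [RHS]big_mkcond /=; apply: eq_bigr => k _.
case: ifPn; last first.
  rewrite !inE xA /= -leNgt => wx.
  have /le_anti -> : w (enum_val k) x <= 0 <= w (enum_val k) x by rewrite wx w0.
  by rewrite mul0r !mulr0.
rewrite !inE xA /= => wx.
have Sn0 : \sum_(y in A) w (enum_val k) y != 0.
  by rewrite gt_eqF // (bigD1 x) //= ltr_pwDl // sumr_ge0.
rewrite gnl_powE gnl_SE gnl_wE exprS; field.
by rewrite Sn0 !gt_eqF.
Qed.

End PowerWeights.

Lemma geometric_eventually_le (R : realType) (q C delta : R) :
  0 <= q < 1 -> 0 < delta -> exists n, C * q ^+ n <= delta.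
Proof.
move=> /andP[q0 q1] delta0.
have q_lt1 : `|q| < 1 by rewrite ger0_norm.
have /cvgr0Pnorm_le /(_ _ delta0)[n _ /(_ n (leqnn n))] := cvg_geometric C q_lt1.
by move=> /(le_trans (ler_norm _)) ?; exists n.
Qed.

(** * Nest weights and their sums over menus *)

Section Nests.
Variables (R : realType) (X : finType) (eps : R).
Hypothesis eps_in : 0 < eps <= 1.

Definition nest_weight (B : {set X}) (x y : X) : R :=
  if y \in B then if y == x then 1 else eps else 0.

Lemma nest_weight_ge0 (B : {set X}) (x y : X) : 0 <= nest_weight B x y.
Proof. by case/andP: eps_in => /ltW ? _; rewrite /nest_weight; do 2?case: ifP. Qed.

Lemma nest_weight_le1 (B : {set X}) (x y : X) : nest_weight B x y <= 1.
Proof. by case/andP: eps_in => _ ?; rewrite /nest_weight; do 2?case: ifP. Qed.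

Lemma nest_weight_geeps (B : {set X}) (x y : X) : y \in B -> eps <= nest_weight B x y.
Proof. by case/andP: eps_in => _ ?; rewrite /nest_weight => ->; case: ifP. Qed.

Lemma nest_weight_sumI (A B : {set X}) (x : X) :
  \sum_(y in A) nest_weight B x y = \sum_(y in A :&: B) nest_weight B x y.
Proof.
rewrite (big_setID B) /= [X in _ + X]big1 ?addr0 // => y.
by rewrite inE => /andP[/negPf yB _]; rewrite /nest_weight yB.
Qed.

Lemma nest_weight_sum_gt0 (B : {set X}) (x : X) : x \in B -> 0 < \sum_(y in B) nest_weight B x y.
Proof.
move=> xB; rewrite (bigD1 x) //= ltr_pwDl //; last first.
  by apply: sumr_ge0 => y _; exact: nest_weight_ge0.
by rewrite /nest_weight xB eqxx.
Qed.

Lemma nest_weight_sum_sub (A B : {set X}) (x : X) : B \subset A ->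
  \sum_(y in A) nest_weight B x y = \sum_(y in B) nest_weight B x y.
Proof. by move=> /setIidPr BA; rewrite nest_weight_sumI BA. Qed.

Lemma nest_weight_sum_nsub (A B : {set X}) (x : X) : ~~ (B \subset A) ->
  \sum_(y in A) nest_weight B x y <=
    (1 - eps / #|X|.+1%:R) * \sum_(y in B) nest_weight B x y.
Proof.
move=> /subsetPn[z zB zA]; have /andP[eps0 eps1] := eps_in.
set S := \sum_(y in B) _.
have SX : S <= #|X|.+1%:R.
  apply: (@le_trans _ _ (\sum_(y in B) 1)).
    by apply: ler_sum => y _; exact: nest_weight_le1.
  by rewrite sumr_const ler_nat (leq_trans (max_card _)).
(* The missing [z] costs at least [eps], which is at least the fraction [eps / #|X|.+1] of the total
   [S]. *)
apply: (@le_trans _ _ (S - eps)).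
  rewrite lerBrDr nest_weight_sumI /S [leRHS](big_setID A) /= [B :&: A]setIC lerD2l.
  rewrite (bigD1 z) /=; last by rewrite inE zA.
  apply: ler_wpDr; last exact: nest_weight_geeps.
  by apply: sumr_ge0 => y _; exact: nest_weight_ge0.
rewrite mulrBl mul1r lerD2l lerN2 -mulrA ler_piMr ?(ltW eps0) //.
by rewrite mulrC ler_pdivrMr ?mul1r.
Qed.

End Nests.

(** * The rescaled coefficient matrix *)

Section NestMatrix.
Variables (R : realType) (X : finType) (delta : R) (n : nat).
Hypothesis delta_in : 0 < delta <= 1.
Hypothesis n_large :
  delta ^- #|X| * (1 - delta / #|X|.+1%:R) ^+ n <= delta.

(** Row [(A, y)] is multiplied by [delta ^+ #|A|], and column [(B, x)] divided by [delta ^+ #|B|]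
    times the [n]-th power of the nest's total weight. *)
Definition nest_matrix (A : {set X}) (y : X) (B : {set X}) (x : X) : R :=
  delta ^+ #|A| / delta ^+ #|B| * nest_weight delta B x y *
  ((\sum_(z in A) nest_weight delta B x z) /
   (\sum_(z in B) nest_weight delta B x z)) ^+ n.

Lemma nest_matrix_diag (A : {set X}) (y : X) : y \in A -> nest_matrix A y A y = 1.
Proof.
move=> yA; have /andP[d0 _] := delta_in.
rewrite /nest_matrix !divff ?expf_neq0 ?gt_eqF ?nest_weight_sum_gt0 //.
by rewrite expr1n mulr1 mul1r /nest_weight yA eqxx.
Qed.

Lemma nest_matrix_offdiag (A : {set X}) (y : X) (B : {set X}) (x : X) : y \in A -> x \in B -> (A, y) != (B, x) ->
  `|nest_matrix A y B x| <= delta.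
Proof.
move=> yA xB neq; have /andP[d0 d1] := delta_in.
have w0 C z t := nest_weight_ge0 delta_in C z t.
have S0 : 0 < \sum_(z in B) nest_weight delta B x z by exact: nest_weight_sum_gt0.
have d0' k : 0 <= delta ^+ k by rewrite exprn_ge0 // ltW.
rewrite /nest_matrix ger0_norm; last first.
  by rewrite !mulr_ge0 ?invr_ge0 // exprn_ge0 // divr_ge0 ?sumr_ge0 // ltW.
have [BA|nBA] := boolP (B \subset A).
  rewrite nest_weight_sum_sub // divff ?gt_eqF // expr1n mulr1.
  have [eBA|nBA] := eqVneq B A.
    subst B; rewrite divff ?expf_neq0 ?gt_eqF // mul1r /nest_weight yA.
    by case: (eqVneq y x) neq => [->|//]; rewrite eqxx.
  have ltBA : (#|B| < #|A|)%N by rewrite proper_card // properEneq nBA.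
  (* The exponent [#|A| - #|B|] is at least one, so a factor [delta] splits off. *)
  rewrite -(subnK ltBA) -addSnnS exprD mulfK ?expf_neq0 ?gt_eqF //.
  rewrite exprS -mulrA ler_piMr ?(ltW d0) //.
  by rewrite mulr_ile1 ?nest_weight_le1 // exprn_ile1 // ltW.
(* The scaling factor is at most [delta ^- #|X|], and the ratio of the sums is at most the base of
   the power in [n_large]. *)
apply: le_trans n_large; apply: ler_pM.
- by rewrite !mulr_ge0 ?invr_ge0.
- by rewrite exprn_ge0 // divr_ge0 ?sumr_ge0 // ltW.
- rewrite -[leRHS]mulr1 ler_pM ?nest_weight_le1 ?mulr_ge0 ?invr_ge0 //.
  rewrite -[leRHS]mul1r ler_pM ?invr_ge0 ?exprn_ile1 ?(ltW d0) //.
  rewrite lef_pV2 ?posrE ?exprn_gt0 //.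
  by apply: ler_wiXn2l; rewrite ?(ltW d0) ?max_card.
- apply: lerXn2r; rewrite ?nnegrE ?divr_ge0 ?sumr_ge0 ?(ltW S0) //.
    by rewrite subr_ge0 ler_pdivrMr // mul1r (le_trans d1) // ler1n.
  by rewrite ler_pdivrMr // nest_weight_sum_nsub.
Qed.

End NestMatrix.

(** * Choice of the constants and solution of the system *)

Theorem theorem4 (R : realType) (X : finType) (p : X -> {set X} -> R) :
  positive_scf p -> is_unrestricted_cnl p.
Proof.
move=> pP.
pose I : finType := {Ax : {set X} * X | Ax.2 \in Ax.1}.
pose mkI (A : {set X}) x (xA : x \in A) : I :=
  exist (fun Ax : {set X} * X => Ax.2 \in Ax.1) (A, x) xA.
have iP (i : I) : (val i).2 \in (val i).1 := valP i.
pose b (i : I) := p (val i).2 (val i).1.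
have An0 (A : {set X}) x : x \in A -> A != set0.
  by move=> xA; apply/set0Pn; exists x.
have b0 i : 0 < b i.
  by case: i => -[A x] xA; have [_ _] := pP _ (An0 _ _ xA); apply.
have b1 i : b i <= 1.
  case: i => -[A x] xA; rewrite /b /=; have [<- _ p0] := pP _ (An0 _ _ xA).
  rewrite (bigD1 x) //= lerDl sumr_ge0 // => y /andP[yA _].
  exact/ltW/p0.
(* The default [1] covers an empty [I]. *)
pose beta := \big[Order.min/1]_i b i.
have beta0 : 0 < beta by apply: lt_bigmin.
have beta1 : beta <= 1 by exact: bigmin_le_id.
have betab i : beta <= b i by exact: bigmin_le.
(* The [4] gives both [#|I| * delta <= 1/2] and [2 * #|I| * delta < beta]; [n] is chosen only after
   [delta]. *)
pose delta := beta / (4 * #|I|.+1%:R).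
have N0 : 0 < #|I|.+1%:R :> R by rewrite ltr0n.
have Ndelta : #|I|%:R * delta <= beta / 4.
  rewrite /delta invfM mulrCA ler_pM2l // mulrCA ler_piMr ?invr_ge0 // ler_pdivrMr //.
  by rewrite mul1r ler_nat.
have delta0 : 0 < delta by rewrite divr_gt0 ?mulr_gt0.
have delta1 : delta <= 1.
  rewrite ler_pdivrMr ?mulr_gt0 // mul1r (le_trans beta1) //.
  by rewrite -natrM ler1n.
have delta_in : 0 < delta <= 1 by rewrite delta0.
have q_in : 0 <= 1 - delta / #|X|.+1%:R < 1.
  rewrite subr_ge0 ler_pdivrMr // mul1r (le_trans delta1) ?ler1n //=.
  by rewrite ltrBlDr ltrDl divr_gt0.
have [n n_large] := geometric_eventually_le (delta ^- #|X|) q_in delta0.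
pose M (i j : I) := nest_matrix delta n (val i).1 (val i).2 (val j).1 (val j).2.
have diagM i : M i i = 1 by exact: nest_matrix_diag.
have offdiagM i j : i != j -> `|M i j| <= delta.
  by case: i j => -[A y] yA [[B x] xB] ij; exact: nest_matrix_offdiag.
have b_in i : beta <= b i <= 1 by rewrite betab b1.
have [||d d0 Md] := near_id_pos_solution diagM offdiagM (ltW delta0) _ b_in beta0.
- by lra.
- by lra.
pose w (i : I) := nest_weight delta (val i).1 (val i).2.
pose S (i : I) := \sum_(z in (val i).1) w i z.
have S0 i : 0 < S i by exact: nest_weight_sum_gt0.
(* These scales undo the column rescaling, and [m] undoes that of the rows. *)
apply: (@cnl_of_weights _ _ _ I w (fun i => d i / (delta ^+ #|(val i).1| * S i ^+ n))
  (fun A => delta ^- #|A|) n) => //.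
- by move=> i x; exact: nest_weight_ge0.
(* The singleton nest at [x] has weight [1] there. *)
- by move=> x; exists (mkI _ _ (set11 x)); rewrite /w /nest_weight /= inE eqxx.
- by move=> i; rewrite divr_gt0 // mulr_gt0 ?exprn_gt0.
- by move=> A; rewrite invr_gt0 exprn_gt0.
move=> A x xA; pose i := mkI _ _ xA.
rewrite -[p x A]/(b i) -Md mulr_sumr; apply: eq_bigr => j _.
rewrite /M /nest_matrix /= -/(w j) -/(S j) [(_ / S j) ^+ n]expr_div_n.
by field; rewrite !expf_neq0 ?gt_eqF.
Qed.
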